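(* Let $(\mathfrak g,A,\varphi)$ be a $7$-dimensional almost Abelian Lie algebra with $A\ne0$ and coclosed $\mathrm G_2$-structure $\varphi$. If $(\mathfrak g,A,\varphi)$ is an algebraic or semi-algebraic soliton for the Laplacian coflow, then it is expanding, unless $\varphi$ is torsion-free, in which case it is steady.
   Context: Almost Abelian setting: $\mathfrak g$ is a $7$-dimensional Lie algebra with an Abelian ideal $\mathfrak h\cong\mathbb R^6$ of codimension one, with a $\mathrm G_2$-structure which in an orthonormal basis $e_1,\dots,e_7$ with $\mathfrak h=\mathrm{span}(e_1,\dots,e_6)$ is $\varphi=\omega\wedge e^7+\rho^+$, where $\omega=e^{12}+e^{34}+e^{56}$, $\rho^+=e^{135}-e^{146}-e^{245}-e^{236}$. The dual form is $\psi=*\varphi=\frac12\omega^2+\rho^-\wedge e^7$ with $\rho^-=-e^{246}+e^{235}+e^{145}+e^{136}$, and $J$ is the complex structure on $\mathbb R^6$ with $\omega=\langle J\cdot,\cdot\rangle$. The bracket is encoded by $A=\mathrm{ad}(e_7)|_{\mathfrak h}\in\mathfrak{gl}(\mathbb R^6)$. The structure is coclosed ($\mathrm d\psi=0$) iff $A\in\mathfrak{sp}(\mathbb R^6)=\{A: AJ+JA^t=0\}$; it is torsion-free if in addition $\mathrm d\varphi=0$. For $B\in\mathfrak{gl}(\mathfrak g)$, $\theta(B)\psi=-\psi(B\cdot,\cdot,\cdot,\cdot)-\dots-\psi(\cdot,\cdot,\cdot,B\cdot)$. $Q_A$ is the symmetric endomorphism of $\mathfrak g$ with $\Delta_A\psi=\theta(Q_A)\psi$,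 where $\Delta_A$ is the Hodge Laplacian on left-invariant forms; it is block diagonal with respect to $\mathfrak h\oplus\mathbb Re_7$ with blocks $\frac12[A,A^t]+\frac12S_A\circ_6S_A$ and $-\frac12\operatorname{tr}S_A^2-\frac14(\operatorname{tr}JA)^2$, where $S_A=\frac12(A+A^t)$ and $(S\circ_6S)_{ab}=S_{mn}S_{pq}\rho^+_{mpa}\rho^+_{nqb}$. $(\mathfrak g,A,\varphi)$ is a semi-algebraic soliton if $Q_A=cI_7+\frac12(D+D^t)$ for some $c\in\mathbb R$ and some derivation $D$ of $\mathfrak g$; algebraic if moreover $D^t$ is a derivation. With $\lambda=-4c$ (the constant in the soliton equation $\Delta_\psi\psi=\lambda\psi+\mathcal L_X\psi$), the soliton is expanding, steady or shrinking if $\lambda>0$, $\lambda=0$ or $\lambda<0$, respectively. *)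

(* Defs.v *)
From mathcomp Require Import all_boot all_order all_algebra.
From mathcomp Require Import reals.

Set Implicit Arguments.
Unset Strict Implicit.
Unset Printing Implicit Defensive.

Import GRing.Theory Num.Theory.
Local Open Scope ring_scope.

(* The Lie algebra g is R^7 = 'rV[R]_7 with its standard orthonormal basis
   e_1, ..., e_7, and h = span(e_1, ..., e_6).  Vectors are rows, so an
   endomorphism B sends u to u *m B; the metric adjoint of B is B^T. *)

(* A k-form is evaluated on the k rows of a matrix. *)
Definition form (R : realType) (k : nat) := 'M[R]_(k, 7) -> R.

Section Bracket.
Variable R : realType.
Variable br : 'rV[R]_7 -> 'rV[R]_7 -> 'rV[R]_7.

Definition derivation (D : 'M[R]_7) : Prop :=
  forall x y, br x y *m D = br (x *m D) y + br x (y *m D).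

(* Chevalley-Eilenberg differential of left-invariant forms,
     d alpha (v_0, ..., v_k)
       = \sum_(i < j) (-1)^(i+j) alpha ([v_i, v_j], v_0, ..^.., ..^.., v_k).
   For i < j one has lift j i = i as numbers, so i can range over the
   indices that remain once row j is removed. *)
Definition ext_d (k : nat) (alpha : form R k.+1) : form R k.+2 := fun v =>
  \sum_(j < k.+2) \sum_(i < k.+1 | (i < j)%N)
    (-1) ^+ (i + j) *
    alpha (col_mx (br (row (lift j i) v) (row j v)) (row' i (row' j v))).

(* Hodge star for the volume form e^{1234567}:
     ( *alpha)(v) = 1/k! \sum_I alpha (e_I) vol (e_I, v),
   I ranging over all index maps.  It is meant for k + l = 7, where conform_mx
   is a mere cast; otherwise it yields 0. *)
Definition hodge (k l : nat) (alpha : form R k) : form R l := fun v =>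
  k`!%:R^-1 * \sum_(I : {ffun 'I_k -> 'I_7})
    alpha (rowsub I 1%:M) *
    \det (conform_mx (0 : 'M[R]_7) (col_mx (rowsub I 1%:M) v)).

(* d^* = (-1)^k * d * on k-forms in dimension 7, here in degree k + 1 *)
Definition codiff (k : nat) (alpha : form R k.+1) : form R k := fun v =>
  (-1) ^+ k.+1 * hodge (ext_d (hodge (l := (5 - k).+1) alpha)) v.

(* On 1-forms the term d d^* vanishes, since left-invariant functions are
   constant. *)
Definition hodge_laplacian (k : nat) (alpha : form R k.+1) : form R k.+1 :=
  match k return form R k.+1 -> form R k.+1 with
  | 0 => fun alpha => codiff (ext_d alpha)
  | k'.+1 => fun alpha v => ext_d (codiff alpha) v + codiff (ext_d alpha) v
  end alpha.

End Bracket.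

Definition theta (R : realType) (k : nat) (B : 'M[R]_7) (alpha : form R k) :
    form R k := fun v =>
  - \sum_(i < k)
      alpha (\matrix_(a, b) (if a == i then (v *m B) a b else v a b)).

(* e^{s_1 ... s_k}, with indices numbered from 1 as usual *)
Definition coform (R : realType) (k : nat) (s : seq nat) : form R k := fun v =>
  \det (\matrix_(a < k, b < k) v a (inZp (nth 1%N s b).-1)).

(* omega /\ e^7 + rho^+ *)
Definition phi (R : realType) : form R 3 := fun v =>
  let e s := coform s v in
  e [:: 1; 2; 7]%N + e [:: 3; 4; 7]%N + e [:: 5; 6; 7]%N
  + (e [:: 1; 3; 5]%N - e [:: 1; 4; 6]%N - e [:: 2; 4; 5]%N
     - e [:: 2; 3; 6]%N).

Definition psi (R : realType) : form R 4 := hodge (@phi R).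

(* [e_7, x] = x *m A for x in h, and h is an Abelian ideal *)
Definition almost_abelian_bracket (R : realType) (A : 'M[R]_6)
    (x y : 'rV[R]_7) : 'rV[R]_7 :=
  let h_part (z : 'rV[R]_(6 + 1)) := lsubmx z in
  row_mx (x 0 ord_max *: (h_part y *m A) - y 0 ord_max *: (h_part x *m A))
         (0 : 'rV[R]_1).

Section Soliton.
Variables (R : realType) (A : 'M[R]_6).
Local Notation br := (almost_abelian_bracket A).

Definition coclosed : Prop := forall v, ext_d br (@psi R) v = 0.

Definition torsion_free : Prop :=
  coclosed /\ (forall v, ext_d br (@phi R) v = 0).

(* Q is the symmetric endomorphism Q_A; B |-> theta B psi is injective on
   symmetric endomorphisms, so there is at most one. *)
Definition is_QA (Q : 'M[R]_7) : Prop :=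
  Q^T = Q /\
  (forall v, hodge_laplacian br (@psi R) v = theta Q (@psi R) v).

Definition semi_algebraic_soliton (c : R) : Prop :=
  exists Q D : 'M[R]_7,
    [/\ is_QA Q, derivation br D & Q = c%:M + 2^-1 *: (D + D^T)].

Definition algebraic_soliton (c : R) : Prop :=
  exists Q D : 'M[R]_7,
    [/\ is_QA Q, derivation br D, derivation br D^T &
        Q = c%:M + 2^-1 *: (D + D^T)].

End Soliton.

(* The constant lambda of Delta_psi psi = lambda psi + L_X psi. *)
Definition soliton_constant (R : realType) (c : R) : R := - 4 * c.

Definition expanding (R : realType) (lambda : R) : Prop := 0 < lambda.
Definition steady (R : realType) (lambda : R) : Prop := lambda = 0.

(* Main.v *)
Require Import Defs.
From mathcomp Require Import all_boot all_order all_algebra.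
From mathcomp Require Import perm reals zify ring lra.

Set Implicit Arguments.
Unset Strict Implicit.
Unset Printing Implicit Defensive.
Import Order.TTheory GRing.Theory Num.Theory.
Local Open Scope ring_scope.

(** Why solitons expand.

    Write S for the symmetric part of A, C for A^T A - A A^T, |.| for the
    Frobenius norm and Q_h for the block of Q_A on h.  Two facts are played
    against each other.

    The derivation.  Vectors being rows, comparing the h-parts of D [e_7, x] and
    [D e_7, x] + [e_7, D x] gives A D_h = a A + D_h A, where D_h is the block of
    D on h and a the e_7-coordinate of D e_7, even if D does not preserve h.
    Since C is symmetric and traceless, the soliton equation Q_A = c + sym D
    then yields tr (Q_h C) = tr (D_h C) = a |A|^2 = (Q_77 - c) |A|^2
    ([trace_identity]).

    The curvature.  For A in sp(R^6) one has Q_h = (C + P) / 2 with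
    P = S o_6 S ([QA_horizontal]) and Q_77 = - |S|^2 / 2 - (tr JA)^2 / 4
    ([QA_vertical]).  Completing the square,
      2 tr (Q_h C) = |C + P / 2|^2 - |P|^2 / 4 >= - |P|^2 / 4.

    What remains is to compare |P| with |S|.  As S anticommutes with J it is a
    complex 3 x 3 matrix, P is four times its conjugate cofactor matrix, and
    the Lagrange identity bounds two rows of minors by a product of row norms,
    so |P|^2 <= 8/3 |S|^4 ([circ6_bound]).  With |S| <= |A| all this gives
      c <= - (|S|^2 / 6 + (tr JA)^2 / 4)      ([soliton_bound]),
    hence c < 0 unless S = 0 and tr JA = 0, that is A in su(3), which is the
    torsion-free case ([torsion_free_sufficient]).  When phi is torsion-free,
    the Laplacian of psi vanishes, so Q_A = 0 and the trace identity reads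
    0 = - c |A|^2.

    The formulas for Q_A come from a direct computation of d * d phi.  All the
    forms involved are combinations of coframe monomials e^{s_1 ... s_k} with
    coefficients polynomial in the entries of A, so they are represented by
    lists; the Hodge star and the differential act on such lists
    ([hodge_form_eval], [ext_d_form_eval]), and what is left of the computation
    is the evaluation of closed list expressions. *)

(** * Coframe monomials as minors, and their Hodge star *)

Definition idx (k : nat) (s : seq nat) (a : 'I_k) : 'I_7 := inZp (nth 1%N s a).-1.

Definition frame (R : realType) (k : nat) (s : seq nat) : 'M[R]_(k, 7) :=
  rowsub (@idx k s) 1%:M.

Lemma coformE (R : realType) k s (v : 'M[R]_(k, 7)) :
  coform s v = \det (colsub (@idx k s) v).
Proof. by congr (\det _); apply/matrixP=> a b; rewrite !mxE. Qed.

(* In this part conform_mx only serves to see a matrix of size k + l as one of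
   size n = k + l. *)
Section Determinants.
Variable R : comNzRingType.

Lemma det_col_row_perm n k l (e : (k + l)%N = n) (X : 'M[R]_(k, n))
    (v : 'M[R]_(l, n)) (p : 'S_k) :
  \det (conform_mx (0 : 'M_n) (col_mx (row_perm p X) v)) =
  (-1) ^+ p * \det (conform_mx (0 : 'M_n) (col_mx X v)).
Proof.
move: X v; case: _ / e => X v; rewrite !conform_mx_id.
have -> : col_mx (row_perm p X) v =
    block_mx (perm_mx p) 0 0 1%:M *m col_mx X v.
  by rewrite mul_block_col !mul0mx addr0 add0r mul1mx -row_permE.
by rewrite det_mulmx det_lblock det1 mulr1 det_perm.
Qed.

(** With f and g jointly a bijection, the rows of the identity selected by f and
    g form an orthogonal matrix M; right multiplication by M^T moves the columns
    selected by f in front of those selected by g, which makes the left-hand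
    matrix block triangular. *)
Lemma det_col_rowsub n k l (e : (k + l)%N = n) (f : 'I_k -> 'I_n)
    (g : 'I_l -> 'I_n) (v : 'M[R]_(l, n)) :
    injective f -> injective g -> (forall a b, f a != g b) ->
  \det (conform_mx (0 : 'M_n) (col_mx (rowsub f 1%:M) v)) =
  \det (conform_mx (0 : 'M_n) (col_mx (rowsub f 1%:M) (rowsub g 1%:M)))
  * \det (colsub g v).
Proof.
move: f g v; case: _ / e => f g v injf injg dfg; rewrite !conform_mx_id.
set F := rowsub f 1%:M; set G := rowsub g 1%:M.
have subE p m (h : 'I_m -> 'I_(k + l)) (w : 'M[R]_(p, k + l)) :
    w *m (rowsub h 1%:M)^T = colsub h w.
  by rewrite trmx_mxsub trmx1 mulmx_colsub mulmx1.
have FF : F *m F^T = 1%:M.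
  by rewrite subE; apply/matrixP=> a b; rewrite !mxE (inj_eq injf).
have FG : F *m G^T = 0.
  by rewrite subE; apply/matrixP=> a b; rewrite !mxE (negPf (dfg a b)).
have GF : G *m F^T = 0 by rewrite -[LHS]trmxK trmx_mul trmxK FG trmx0.
have GG : G *m G^T = 1%:M.
  by rewrite subE; apply/matrixP=> a b; rewrite !mxE (inj_eq injg).
have MM : \det (col_mx F G) * \det (col_mx F G) = 1.
  rewrite -{2}det_tr -det_mulmx tr_col_mx mul_col_row FF FG GF GG.
  by rewrite -scalar_mx_block det1.
have : \det (col_mx F v) * \det (col_mx F G) = \det (colsub g v).
  rewrite -[\det (col_mx F G)]det_tr -det_mulmx tr_col_mx mul_col_row FF FG.
  by rewrite det_lblock det1 mul1r subE.
by move=> <-; rewrite mulrCA MM mulr1.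
Qed.

End Determinants.

Section Hodge.
Variable R : realType.

(** Expanding the k x k minor of the monomial by the Leibniz formula, the sum over
    index maps I collapses to the k! reorderings of s, and both factors carry the
    sign of the reordering. *)
Lemma hodge_coform k l s (v : 'M[R]_(l, 7)) : (k + l = 7)%N ->
  hodge (@coform R k s) v =
  \det (conform_mx (0 : 'M_7) (col_mx (frame R k s) v)).
Proof.
move=> e; rewrite /hodge.
pose F (X : 'M[R]_(k, 7)) := \det (conform_mx (0 : 'M_7) (col_mx X v)).
rewrite -/(F _).
have -> : \sum_(I : {ffun 'I_k -> 'I_7}) coform s (rowsub I 1%:M)
             * F (rowsub I 1%:M) =
    \sum_(p : 'S_k) (-1) ^+ p * F (row_perm p (frame R k s)).
  under eq_bigr do rewrite coformE /determinant mulr_suml.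
  rewrite exchange_big; apply: eq_bigr => p _ /=.
  pose I0 := [ffun a => idx s (p a)].
  rewrite (bigD1 I0) //= [X in _ + X]big1 ?addr0 => [|I neI].
    rewrite big1 ?mulr1 => [|a _]; last by rewrite !mxE ffunE eqxx.
    congr (_ * F _); apply/matrixP=> a b; rewrite !mxE ffunE //.
  have /existsP[a na] : [exists a, I a != I0 a].
    rewrite -negb_forall; apply: contra neI => /forallP h.
    by apply/eqP/ffunP=> a; apply/eqP/h.
  rewrite (bigD1 a) //= !mxE; move: na; rewrite ffunE => /negPf ->.
  by rewrite !(mul0r, mulr0).
under eq_bigr => p _.
  rewrite /F (det_col_row_perm e) mulrA -exprD addnn -signr_odd odd_double.
  by rewrite mul1r; over.
rewrite sumr_const -[X in _ * X]mulr_natl mulrA.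
by rewrite card_Sn mulVf ?mul1r // pnatr_eq0 -lt0n fact_gt0.
Qed.

End Hodge.

(** * Generalized Kronecker symbols *)

(** The generalized Kronecker symbol: the sign of the permutation taking s to J,
    and 0 if there is none.  The Laplace expansion along the first entry of J is used
    as definition because it computes on lists. *)
Fixpoint kron (s J : seq nat) : int :=
  if J is x :: J' then
    if x \in s then (-1) ^+ index x s * kron (rem x s) J' else 0
  else 1.

Lemma nth_rem (x : nat) s i :
  nth 1%N (rem x s) i = nth 1%N s (bump (index x s) i).
Proof.
elim: s i => [|y s IH] i /=; first by rewrite !nth_nil.
by case: eqP => // _; case: i => [|i] //=; rewrite IH bumpS.
Qed.

Lemma det_kron (R : comNzRingType) k s J : uniq s -> size s = k -> size J = k ->
  \det (\matrix_(a < k, b < k) (nth 1%N J a == nth 1%N s b)%:R : 'M[R]_k) =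
  (kron s J)%:~R.
Proof.
elim: J k s => [|x J IH] [|k] s //= us sz; first by rewrite det_mx00.
case=> szJ; rewrite (expand_det_row _ ord0).
case: ifPn => [xs|/negP xs]; last first.
  rewrite big1 // => b _; rewrite mxE /= -[X in X * _](_ : 0 = _) ?mul0r //.
  by case: eqP => // e; case: xs; rewrite e mem_nth ?sz.
have ix : (index x s < k.+1)%N by rewrite -sz index_mem.
rewrite (bigD1 (Ordinal ix)) //= [X in _ + X]big1 => [|b nb]; last first.
  rewrite mxE /= -[X in X * _](_ : 0 = _) ?mul0r //.
  case: eqP => // e; case/eqP: nb; apply/val_inj => /=.
  by rewrite e index_uniq ?sz.
rewrite addr0 mxE /= nth_index // eqxx mul1r /cofactor add0n rmorphM /=.
rewrite rmorphXn rmorphN1 /=; congr (_ * _).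
rewrite -(IH k) ?rem_uniq ?size_rem ?sz //.
congr (\det _); apply/matrixP => a b; rewrite !mxE /=.
by rewrite nth_rem.
Qed.

(** * The differential of a coframe monomial *)

Section ExtD.
Variable R : realType.

(** The adjoint action of e_7 on the whole of g. *)
Definition ad7 (A : 'M[R]_6) : 'M[R]_7 :=
  block_mx A 0 0 (0 : 'M_1) : 'M_(6 + 1).

Lemma bracketE A (x y : 'rV[R]_7) : almost_abelian_bracket A x y =
  x 0 ord_max *: (y *m ad7 A) - y 0 ord_max *: (x *m ad7 A).
Proof.
have h (z : 'rV[R]_(6 + 1)) :
    z *m (block_mx A 0 0 0 : 'M_(6 + 1)) = row_mx (lsubmx z *m A) 0.
  by rewrite -[z in LHS]hsubmxK mul_row_block !mulmx0 !addr0.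
have hrow a b (u w : 'rV[R]_6) : row_mx (a *: u - b *: w) (0 : 'rV_1) =
    a *: row_mx u 0 - b *: row_mx w 0.
  by rewrite !scale_row_mx opp_row_mx add_row_mx !scaler0 subr0.
by rewrite /almost_abelian_bracket /ad7 !h; exact: hrow.
Qed.

Lemma col_mx0E k n (x : 'rV[R]_n) (w : 'M[R]_(k, n)) j :
  (col_mx x w : 'M_(k.+1, n)) ord0 j = x 0 j.
Proof.
have -> : ord0 = lshift k (ord0 : 'I_1) by apply: val_inj.
exact: col_mxEu.
Qed.

Lemma col_mxSE k n (x : 'rV[R]_n) (w : 'M[R]_(k, n)) i j :
  (col_mx x w : 'M_(k.+1, n)) (lift ord0 i) j = w i j.
Proof.
have -> : lift ord0 i = rshift 1 i by apply: val_inj.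
exact: col_mxEd.
Qed.

Lemma coform_col_mx k s (x : 'rV[R]_7) (w : 'M[R]_(k, 7)) :
  coform s (col_mx x w : 'M_(k.+1, 7)) =
  \sum_(c < k.+1) x 0 (idx s c)
     * ((-1) ^+ c * \det (col' c (colsub (@idx k.+1 s) w))).
Proof.
rewrite coformE (expand_det_row _ ord0); apply: eq_bigr => c _.
rewrite [X in X * _]mxE col_mx0E /cofactor add0n; congr (_ * (_ * \det _)).
by apply/matrixP => a b; rewrite 3!mxE col_mxSE !mxE.
Qed.

Lemma coform_col_mxB k s a b (x y : 'rV[R]_7) (w : 'M[R]_(k, 7)) :
  coform s (col_mx (a *: x - b *: y) w : 'M_(k.+1, 7)) =
  a * coform s (col_mx x w : 'M_(k.+1, 7))
  - b * coform s (col_mx y w : 'M_(k.+1, 7)).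
Proof.
rewrite !coform_col_mx !mulr_sumr -sumrB; apply: eq_bigr => c _.
by rewrite !mxE mulrBl !mulrA.
Qed.

(** If n numbers the rows left once row m is removed, then m <= n encodes the pair
    of rows m and n + 1.  If i numbers the rows left once row j is removed, then
    i < j encodes the pair of rows i and j.  So m = i and n = j - 1 match. *)
Lemma sum_lift_exchange k (F : 'I_k.+2 -> 'I_k.+1 -> R) :
  \sum_(j < k.+2) \sum_(i < k.+1 | (i < j)%N)
     F (lift j i) (inord j.-1) =
  \sum_(m < k.+2) \sum_(n < k.+1 | (m <= n)%N) F m n.
Proof.
rewrite !pair_big_dep /=.
rewrite [RHS](reindex_onto
  (fun p : 'I_k.+2 * 'I_k.+1 => (lift p.1 p.2, inord p.1.-1))
  (fun p : 'I_k.+2 * 'I_k.+1 => (lift p.1 p.2, inord p.1))) /=.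
  apply: eq_bigl => -[j i] /=; have := ltn_ord j; have := ltn_ord i => iK jK.
  apply/idP/andP => [ij|[]].
    have jk : (j.-1 < k.+1)%N by lia.
    have lij : bump j i = i by rewrite /bump leqNgt ij.
    split; first by rewrite lij inordK //; lia.
    apply/eqP; congr pair; apply/val_inj => /=; last by rewrite lij inordK.
    by rewrite lij inordK // /bump; lia.
  move=> h /eqP [] /(congr1 val) /= e1 e2.
  case: (ltnP i j) h e1 => // ji; rewrite /bump ji add1n inordK; last by lia.
  by lia.
move=> [m n] /= mn; have := ltn_ord m; have := ltn_ord n => nK mK.
have lmn : bump m n = n.+1 by rewrite /bump mn.
congr pair; apply/val_inj; rewrite /= lmn inordK //; last by lia.
by rewrite /bump; lia.
Qed.

Lemma row'_lift k n (v : 'M[R]_(k.+2, n)) (j : 'I_k.+2)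
    (i : 'I_k.+1) : (i < j)%N ->
  row' i (row' j v) = row' (inord j.-1) (row' (lift j i) v).
Proof.
move=> ij; apply/matrixP => a b; have := ltn_ord j => jK.
rewrite !mxE; congr (v _ b); apply/val_inj => /=.
rewrite inordK; last by lia.
rewrite /bump; lia.
Qed.

(** This is d e^s = - sum_c e^7 /\ (e^s with its factor e^{s_c} replaced by
    the form x |-> e^{s_c} [e_7, x]), the Leibniz rule for d e^a = - e^7 /\
    (e^a o ad e_7).  Both sides are expanded into sums over a row m, whose e^7
    coordinate is taken, a row n acted on by ad e_7, and a column c; the terms
    n < m and n >= m correspond to the two terms of the bracket. *)
Lemma ext_d_coform A k s (v : 'M[R]_(k.+2, 7)) :
  ext_d (almost_abelian_bracket A) (coform s) v =
  - \sum_(c < k.+1) \sum_(w < 7)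
      ad7 A w (idx s c) * coform (7 :: set_nth 1%N s c w.+1)%N v.
Proof.
rewrite /ext_d.
pose T (m : 'I_k.+2) (n : 'I_k.+1) :=
  v m ord_max *
  coform s (col_mx (row (lift m n) v *m ad7 A) (row' n (row' m v))
            : 'M_(k.+1, 7)).
transitivity (- \sum_(m < k.+2) \sum_(n < k.+1) (-1) ^+ (m + n) * T m n).
  have -> : \sum_(m < k.+2) \sum_(n < k.+1) (-1) ^+ (m + n) * T m n =
     \sum_(m < k.+2) \sum_(n < k.+1 | (n < m)%N) (-1) ^+ (m + n) * T m n +
     \sum_(m < k.+2) \sum_(n < k.+1 | (m <= n)%N) (-1) ^+ (m + n) * T m n.
    rewrite -big_split; apply: eq_bigr => m _.
    rewrite (bigID (fun n : 'I__ => n < m)%N) /=.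
    by congr (_ + _); apply: eq_bigl => n; rewrite -leqNgt.
  rewrite -sum_lift_exchange -big_split -sumrN; apply: eq_bigr => j _ /=.
  rewrite -big_split -sumrN; apply: eq_bigr => i ij /=.
  have lij : bump j i = i by rewrite /bump leqNgt ij.
  have jk : (j.-1 < k.+1)%N by have := ltn_ord j; lia.
  have ll : lift (lift j i) (inord j.-1) = j.
    by apply/val_inj; rewrite /= lij inordK // /bump; lia.
  rewrite bracketE coform_col_mxB /T ll -row'_lift // !mxE.
  have -> : (-1) ^+ (lift j i + (inord j.-1 : 'I_k.+1)) = - (-1) ^+ (i + j) :> R.
    rewrite /= lij inordK // -[in RHS](prednK (leq_trans _ ij)) // addnS exprS.
    by rewrite mulN1r opprK.
  rewrite (addnC j i); ring.
congr (- _).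
have cofE (c : 'I_k.+1) (w : 'I_7) : coform (7 :: set_nth 1%N s c w.+1)%N v =
   \sum_(m < k.+2) \sum_(n < k.+1) (-1) ^+ (m + n) * v m ord_max * v (lift m n) w *
      ((-1) ^+ c * \det (col' c (colsub (@idx k.+1 s) (row' n (row' m v))))).
  rewrite coformE (expand_det_col _ ord0); apply: eq_bigr => m _.
  rewrite /cofactor (expand_det_col _ c) !mulr_sumr; apply: eq_bigr => n _.
  rewrite !mxE /cofactor.
  have -> : idx (7 :: set_nth 1 s c w.+1)%N (ord0 : 'I_k.+2) = ord_max.
    exact: val_inj.
  have -> : idx (7 :: set_nth 1 s c w.+1)%N (lift ord0 c) = w.
    by apply/val_inj; rewrite /= nth_set_nth /= eqxx /= modn_small.
  have -> : row' n (col' c (row' m (col' ord0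
        (colsub (@idx k.+2 (7 :: set_nth 1 s c w.+1)%N) v)))) =
      col' c (colsub (@idx k.+1 s) (row' n (row' m v))).
    apply/matrixP => a b; rewrite !mxE; congr (v _ _).
    by apply/val_inj; rewrite /= nth_set_nth /= eq_sym (negPf (neq_bump _ _)).
  rewrite addn0 !exprD; ring.
transitivity (\sum_(m < k.+2) \sum_(n < k.+1) \sum_(c < k.+1) \sum_(w < 7)
   ad7 A w (idx s c) * ((-1) ^+ (m + n) * v m ord_max * v (lift m n) w *
      ((-1) ^+ c * \det (col' c (colsub (@idx k.+1 s) (row' n (row' m v))))))).
  apply: eq_bigr => m _; apply: eq_bigr => n _; rewrite /T coform_col_mx.
  rewrite !mulr_sumr; apply: eq_bigr => c _.
  rewrite mxE mulr_suml !mulr_sumr; apply: eq_bigr => w _; rewrite mxE; ring.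
under eq_bigr => m _ do rewrite exchange_big /=.
rewrite exchange_big /=; apply: eq_bigr => c _.
under eq_bigr => m _ do rewrite exchange_big /=.
rewrite exchange_big /=; apply: eq_bigr => w _.
rewrite cofE mulr_sumr; apply: eq_bigr => m _.
by rewrite mulr_sumr; apply: eq_bigr => n _.
Qed.

End ExtD.

(** * Forms as lists of coframe monomials *)

(** The integer times the product of the entries of A at the listed positions. *)
Definition monomial := (int * seq (nat * nat))%type.
Definition coframe_term := (monomial * seq nat)%type.

Definition multi_index (k : nat) (s : seq nat) : bool :=
  [&& size s == k, all (fun i => 0 < i <= 7)%N s & uniq s].

Definition complementary (s : seq nat) : seq nat :=
  [seq i <- iota 1 7 | i \notin s].

Definition star_terms (L : seq coframe_term) : seq coframe_term :=
  [seq (t.1.1 * kron (iota 1 7) (t.2 ++ complementary t.2), t.1.2,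
        complementary t.2) | t <- L].

(** The terms left out contain e^7 /\ e^7, or e^7 o ad e_7 = 0, or another repeated
    factor; dropping them keeps every multi-index free of repetitions, which
    [star_terms] relies upon. *)
Definition d_terms (L : seq coframe_term) : seq coframe_term :=
  flatten [seq flatten [seq
    [seq (- t.1.1, (w, nth 1%N t.2 c) :: t.1.2, 7%N :: set_nth 1%N t.2 c w)
     | w <- iota 1 6 &
       (nth 1 t.2 c < 7)%N && uniq (7%N :: set_nth 1%N t.2 c w)]
   | c <- iota 0 (size t.2)] | t <- L].

(** The value of a form on (e_J1, ..., e_Jk), as a polynomial in the entries of A. *)
Definition coefs (L : seq coframe_term) (J : seq nat) : seq monomial :=
  [seq (t.1.1 * kron t.2 J, t.1.2) | t <- L & kron t.2 J != 0].

Section Evaluation.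
Variable R : realType.
Implicit Types (A : 'M[R]_6) (L : seq coframe_term).

(** Entries are numbered from 1, in keeping with the usual e_1, ..., e_7. *)
Definition ent n (M : 'M[R]_n.+1) (i j : nat) : R := M (inZp i.-1) (inZp j.-1).

Definition mono_eval A (m : seq (nat * nat)) : R := \prod_(p <- m) ent A p.1 p.2.

Definition poly_eval A (P : seq monomial) : R :=
  \sum_(t <- P) t.1%:~R * mono_eval A t.2.

Definition form_eval A k L : Defs.form R k := fun v =>
  \sum_(t <- L) t.1.1%:~R * mono_eval A t.1.2 * coform t.2 v.

Lemma nth_multi k s (a : 'I_k) : multi_index k s -> (0 < nth 1 s a <= 7)%N.
Proof. by case/and3P=> /eqP sz /allP h _; rewrite h // mem_nth ?sz. Qed.

Lemma idxK k s (a : 'I_k) : multi_index k s -> idx s a = (nth 1 s a).-1 :> nat.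
Proof. by move=> /(nth_multi a) h; rewrite /= modn_small //; lia. Qed.

Lemma idx_eq k l s t (a : 'I_k) (b : 'I_l) : multi_index k s -> multi_index l t ->
  (idx s a == idx t b) = (nth 1 s a == nth 1 t b)%N.
Proof.
move=> ms mt; rewrite -(inj_eq val_inj) [val _]idxK // [val (idx t b)]idxK //.
have /andP[+ _] := nth_multi a ms; have /andP[+ _] := nth_multi b mt.
by case: (nth _ t b) => // y _; case: (nth _ s a).
Qed.

Lemma idx_inj k s : multi_index k s -> injective (@idx k s).
Proof.
move=> ms a b /eqP; rewrite idx_eq //; case/and3P: ms => /eqP sz _ us.
by rewrite nth_uniq ?sz // => /eqP /val_inj.
Qed.

Lemma coform_frame k s J : multi_index k s -> size J = k ->
  all (fun i => 0 < i <= 7)%N J -> coform s (frame R k J) = (kron s J)%:~R.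
Proof.
move=> ms szJ /allP hJ; case/and3P: (ms) => /eqP sz /allP hs us.
rewrite coformE -(det_kron _ us sz szJ); congr (\det _); apply/matrixP => a b.
rewrite !mxE; congr (_%:R); congr nat_of_bool.
have /hs : nth 1%N s b \in s by rewrite mem_nth ?sz.
have /hJ : nth 1%N J a \in J by rewrite mem_nth ?szJ.
rewrite -val_eqE /=.
case: (nth _ J _) => [|x] //= hx; case: (nth _ s _) => [|y] //= hy.
by rewrite !modn_small.
Qed.

Lemma coform_nuniq k s (v : 'M[R]_(k, 7)) :
  size s = k -> ~~ uniq s -> coform s v = 0.
Proof.
move=> sz /(uniqPn 1%N) [i [j [ij js e]]].
have jk : (j < k)%N by rewrite -sz.
rewrite coformE -det_tr.
rewrite (determinant_alternate (i1 := Ordinal (ltn_trans ij jk))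
                               (i2 := Ordinal jk)) //.
  by rewrite -val_eqE /= (ltn_eqF ij).
by move=> a; rewrite !mxE /idx /= e.
Qed.

Lemma complementary_multi k l s :
  (k + l = 7)%N -> multi_index k s -> multi_index l (complementary s).
Proof.
move=> kl /and3P[/eqP sz /allP hs us]; apply/and3P; split.
- rewrite size_filter; have := count_predC (mem s) (iota 1 7).
  rewrite size_iota; have -> : count (mem s) (iota 1 7) = k.
    rewrite -sz -size_filter; apply/perm_size/uniq_perm => //.
      by rewrite filter_uniq ?iota_uniq.
    move=> i; rewrite mem_filter mem_iota /=.
    by case: (boolP (i \in s)) => // /hs /=; lia.
  move=> e; apply/eqP; move: e.
  by rewrite -[X in (_ + X)%N]/(count (fun i => i \notin s) (iota 1 7)) /=; lia.
- by apply/allP => i; rewrite mem_filter mem_iota => /andP[_]; lia.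
- by rewrite filter_uniq ?iota_uniq.
Qed.

Lemma conform_col_rowsub n k l (e : (k + l)%N = n) (f : 'I_k -> 'I_n)
    (g : 'I_l -> 'I_n) (h : nat -> 'I_n) :
    (forall a : 'I_k, f a = h a) -> (forall b : 'I_l, g b = h (k + b)%N) ->
  conform_mx (0 : 'M[R]_n) (col_mx (rowsub f 1%:M) (rowsub g 1%:M)) =
  rowsub (fun a : 'I_n => h a) 1%:M.
Proof.
move: f g h; case: _ / e => f g h fh gh; rewrite conform_mx_id.
apply/matrixP => i j; rewrite !mxE.
by case: splitP => a ->; rewrite !mxE ?fh ?gh.
Qed.

Lemma ad7E A (i j : 'I_7) :
  ad7 A i j = if (i < 6)%N && (j < 6)%N then ent A i.+1 j.+1 else 0.
Proof.
rewrite /ad7 -[LHS]/((block_mx A 0 0 0 : 'M_(6 + 1)) i j) !mxE.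
case: splitP => i' ei; rewrite !mxE; case: splitP => j' ej; rewrite ?mxE ei ej.
- rewrite !ltn_ord /ent /=; congr (A _ _); apply/val_inj; by rewrite /= modn_small.
- by rewrite andbC [(_ + _ < _)%N]ltnNge leq_addr.
- by rewrite [(_ + _ < _)%N]ltnNge leq_addr.
- by rewrite [(_ + _ < _)%N]ltnNge leq_addr.
Qed.

Lemma hodge_coform_complementary k l s (v : 'M[R]_(l, 7)) :
    (k + l = 7)%N -> multi_index k s ->
  hodge (@coform R k s) v =
  (kron (iota 1 7) (s ++ complementary s))%:~R * coform (complementary s) v.
Proof.
move=> kl ms; have mc := complementary_multi kl ms.
rewrite hodge_coform // /frame.
rewrite (@det_col_rowsub _ _ _ _ kl _ (@idx l (complementary s))); first last.
- move=> a b; rewrite idx_eq //.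
  case/and3P: ms => /eqP sz _ _; case/and3P: (mc) => /eqP cz _ _.
  have : nth 1%N (complementary s) b \in complementary s by rewrite mem_nth ?cz.
  by rewrite mem_filter => /andP[+ _]; apply: contraNneq => <-; rewrite mem_nth ?sz.
- exact: idx_inj.
- exact: idx_inj.
rewrite -coformE; congr (_ * _).
have [sz szc] : size s = k /\ size (complementary s) = l.
  by case/and3P: ms => /eqP ? _ _; case/and3P: mc => /eqP.
rewrite (@conform_col_rowsub _ _ _ kl _ _
  (fun a => inZp (nth 1%N (s ++ complementary s) a).-1)).
- rewrite -(@coform_frame 7) ?size_cat ?sz ?szc //.
    rewrite coformE; congr (\det _); apply/matrixP => a b; rewrite !mxE.
    congr (_ == _)%:R; apply/val_inj.
    by rewrite [RHS](@idxK 7) // nth_iota.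
  by rewrite all_cat; case/and3P: ms => _ -> _; case/and3P: mc => _ ->.
- by move=> a; rewrite /idx nth_cat sz ltn_ord.
- by move=> b; rewrite /idx nth_cat sz ltnNge leq_addr /= addKn.
Qed.

Lemma hodge_form_eval A k l L v :
    (k + l = 7)%N -> all (fun t => multi_index k t.2) L ->
  hodge (l := l) (@form_eval A k L) v = form_eval A (star_terms L) v.
Proof.
move=> kl mL; rewrite /hodge /form_eval.
transitivity (\sum_(t <- L) t.1.1%:~R * mono_eval A t.1.2 *
    hodge (@coform R k t.2) v).
  under eq_bigr do rewrite mulr_suml.
  rewrite exchange_big mulr_sumr; apply: eq_bigr => t _ /=.
  rewrite /hodge mulrCA; congr (_ * _); rewrite mulr_sumr.
  by apply: eq_bigr => I _; rewrite !mulrA.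
rewrite big_map big_seq [RHS]big_seq; apply: eq_bigr => t /(allP mL) mt.
by rewrite (hodge_coform_complementary _ kl mt) /= intrM; ring.
Qed.

Lemma ext_d_form_eval A k L v : all (fun t => multi_index k.+1 t.2) L ->
  ext_d (almost_abelian_bracket A) (@form_eval A k.+1 L) v =
  form_eval A (d_terms L) v.
Proof.
move=> mL.
transitivity (\sum_(t <- L) t.1.1%:~R * mono_eval A t.1.2 *
    ext_d (almost_abelian_bracket A) (@coform R k.+1 t.2) v).
  rewrite /ext_d /form_eval; under [RHS]eq_bigr do rewrite mulr_sumr.
  rewrite exchange_big /=; apply: eq_bigr => j _.
  under [RHS]eq_bigr do rewrite mulr_sumr.
  rewrite exchange_big /=; apply: eq_bigr => i _.
  by rewrite mulr_sumr; apply: eq_bigr => t _; rewrite mulrCA.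
rewrite /form_eval /d_terms big_flatten big_map.
apply: eq_big_seq => t /(allP mL); move: t => [[z m] s].
rewrite ![(_, _).1]/= ![(_, _).2]/= => ms.
rewrite ext_d_coform big_flatten big_map mulrN mulr_sumr -sumrN.
have sz : size s = k.+1 by case/and3P: ms => /eqP.
rewrite sz -[iota 0 k.+1]/(index_iota 0 k.+1) big_mkord; apply: eq_bigr => c _.
rewrite big_map big_filter big_mkcond -[iota 1 6]/(index_iota 1 7) big_add1 /=.
rewrite big_mkord big_ord_recr /= ad7E /= mul0r addr0 mulr_sumr -sumrN.
apply: eq_bigr => w _; rewrite ad7E idxK //.
rewrite (_ : (widen_ord _ w < 6)%N = true) /=; last exact: ltn_ord.
case: (nth 1%N s c) (nth_multi c ms) => [|y] //= _; rewrite ltnS.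
rewrite -[(y.+1 < 7)%N]/(y <= 5)%N; case: (y <= 5)%N; last first.
  by rewrite mul0r mulr0 oppr0.
case: ifPn => [_|nu] /=; first by rewrite /mono_eval big_cons rmorphN /=; ring.
rewrite coform_nuniq ?mulr0 ?oppr0 //= size_set_nth sz.
by rewrite (maxn_idPr (ltn_ord c)).
Qed.

Definition subst_row k (v : 'M[R]_(k, 7)) (i : 'I_k) (x : 'rV[R]_7)
    : 'M[R]_(k, 7) :=
  \matrix_(a, b) (if a == i then x 0 b else v a b).

Lemma coform_subst_row k s (v : 'M[R]_(k, 7)) i (x : 'rV[R]_7) :
  coform s (subst_row v i x) =
  \sum_c x 0 (idx s c) * cofactor (colsub (@idx k s) v) i c.
Proof.
rewrite coformE (expand_det_row _ i); apply: eq_bigr => c _.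
rewrite !mxE eqxx; congr (_ * (_ * \det _)).
by apply/matrixP => a b; rewrite !mxE eq_sym (negPf (neq_lift _ _)).
Qed.

Lemma coform_subst_frame k s J (i : 'I_k) (x : 'rV[R]_7) :
  coform s (subst_row (frame R k J) i x) =
  \sum_(w < 7) x 0 w * coform s (frame R k (set_nth 1%N J i w.+1)).
Proof.
have fE (w : 'I_7) : frame R k (set_nth 1%N J i w.+1) =
    subst_row (frame R k J) i (delta_mx 0 w).
  apply/matrixP => a b; rewrite !mxE -[a == i]val_eqE /=.
  have -> : idx (set_nth 1%N J i w.+1) a = if a == i :> nat then w else idx J a.
    apply/val_inj; rewrite /= nth_set_nth /=; case: eqP => //= _.
    by rewrite modn_small.
  by case: (_ == _ :> nat) => //=; rewrite ?eqxx eq_sym.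
under [RHS]eq_bigr do rewrite fE coform_subst_row mulr_sumr.
rewrite coform_subst_row exchange_big /=; apply: eq_bigr => c _.
rewrite (bigD1 (idx s c)) //= big1 => [|w /negPf nw].
  by rewrite mxE !eqxx mul1r addr0.
by rewrite mxE eqxx eq_sym nw mul0r mulr0.
Qed.

Lemma form_eval_frame A k L J : all (fun t => multi_index k t.2) L ->
    size J = k -> all (fun i => 0 < i <= 7)%N J ->
  form_eval A L (frame R k J) = poly_eval A (coefs L J).
Proof.
move=> mL szJ hJ; rewrite /form_eval /poly_eval big_map big_filter [RHS]big_mkcond.
rewrite big_seq [RHS]big_seq; apply: eq_bigr => t /(allP mL) mt.
rewrite coform_frame // intrM; case: eqP => [->|_] /=; first by rewrite mulr0.
by rewrite mulrAC.
Qed.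

End Evaluation.

(** * The Laplacian of psi *)

Definition phi_terms : seq coframe_term :=
  [:: (1, [::], [:: 1; 2; 7]%N); (1, [::], [:: 3; 4; 7]%N);
      (1, [::], [:: 5; 6; 7]%N); (1, [::], [:: 1; 3; 5]%N);
      (-1, [::], [:: 1; 4; 6]%N); (-1, [::], [:: 2; 4; 5]%N);
      (-1, [::], [:: 2; 3; 6]%N)].

Definition psi_terms := star_terms phi_terms.
Definition dphi_terms := d_terms phi_terms.
Definition laplacian_terms := d_terms (star_terms dphi_terms).

(** For each entry Q_ab, the polynomial by which it is multiplied in
    - theta(Q) of the form L on (e_J1, ..., e_Jk). *)
Definition theta_terms (L : seq coframe_term) (J : seq nat) :
    seq (nat * nat * seq monomial) :=
  flatten [seq [seq ((nth 1%N J i, w), coefs L (set_nth 1%N J i w))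
     | w <- iota 1 7 & coefs L (set_nth 1%N J i w) != [::]] | i <- iota 0 (size J)].

Section Laplacian.
Variable R : realType.
Implicit Type A : 'M[R]_6.

Lemma eq_hodge k l (al be : Defs.form R k) (v : 'M[R]_(l, 7)) :
  al =1 be -> hodge al v = hodge be v.
Proof. by move=> e; congr (_ * _); apply: eq_bigr => I _; rewrite e. Qed.

Lemma eq_ext_d br k (al be : Defs.form R k.+1) v :
  al =1 be -> ext_d br al v = ext_d br be v.
Proof.
by move=> e; apply: eq_bigr => j _; apply: eq_bigr => i _; rewrite e.
Qed.

Lemma phi_form_eval A : @phi R =1 form_eval A phi_terms.
Proof.
move=> v; rewrite /form_eval /phi_terms !big_cons big_nil /mono_eval !big_nil /=.
by rewrite !mulr1 rmorphN /= /phi; ring.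
Qed.

Lemma psi_form_eval A : @psi R =1 form_eval A psi_terms.
Proof.
by move=> v; rewrite /psi (eq_hodge _ (phi_form_eval A)) hodge_form_eval.
Qed.

Lemma hodge_psi : hodge (@psi R) =1 @phi R.
Proof.
move=> v; rewrite (eq_hodge _ (psi_form_eval 0)) hodge_form_eval //.
by rewrite (phi_form_eval 0).
Qed.

Lemma dphi_form_eval A :
  ext_d (almost_abelian_bracket A) (@phi R) =1 form_eval A dphi_terms.
Proof. by move=> v; rewrite (eq_ext_d _ _ (phi_form_eval A)) ext_d_form_eval. Qed.

Lemma hodge0 k l (v : 'M[R]_(l, 7)) : hodge (fun _ : 'M[R]_(k, 7) => 0) v = 0.
Proof. by rewrite /hodge big1 ?mulr0 // => I _; rewrite mul0r. Qed.

Lemma ext_d0 (br : 'rV[R]_7 -> 'rV[R]_7 -> 'rV[R]_7) k v :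
  ext_d br (fun _ : 'M[R]_(k.+1, 7) => 0) v = 0.
Proof.
by rewrite /ext_d big1 // => j _; rewrite big1 // => i _; rewrite mulr0.
Qed.

(** Since d psi = 0 only the term d d^* psi survives, and * psi = phi. *)
Lemma laplacian_coclosed A : coclosed A ->
  hodge_laplacian (almost_abelian_bracket A) (@psi R) =1
  ext_d (almost_abelian_bracket A)
    (hodge (l := 3) (ext_d (almost_abelian_bracket A) (@phi R))).
Proof.
move=> hA v; rewrite /hodge_laplacian.
have -> : codiff (almost_abelian_bracket A)
    (ext_d (almost_abelian_bracket A) (@psi R)) v = 0.
  rewrite /codiff (@eq_hodge _ _ _ (fun=> 0)) ?hodge0 ?mulr0 // => w.
  rewrite (@eq_ext_d _ _ _ (fun=> 0)) ?ext_d0 // => u.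
  by rewrite (@eq_hodge _ _ _ (fun=> 0)) ?hodge0.
rewrite addr0; apply: eq_ext_d => w; rewrite /codiff -signr_odd expr0 mul1r.
by apply: eq_hodge => u; apply: eq_ext_d => x; rewrite hodge_psi.
Qed.

Lemma laplacian_psi A : coclosed A ->
  hodge_laplacian (almost_abelian_bracket A) (@psi R) =1 form_eval A laplacian_terms.
Proof.
move=> hA v; rewrite laplacian_coclosed //.
rewrite (@eq_ext_d _ _ _ (form_eval A (star_terms dphi_terms))).
  by rewrite ext_d_form_eval //; vm_compute.
move=> w; rewrite (eq_hodge _ (dphi_form_eval A)).
by rewrite hodge_form_eval //; vm_compute.
Qed.

Lemma theta_form_eval A Q k L J : all (fun t => multi_index k t.2) L ->
    size J = k -> all (fun i => 0 < i <= 7)%N J ->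
  theta Q (@form_eval R A k L) (frame R k J) =
  - \sum_(p <- theta_terms L J) ent Q p.1.1 p.1.2 * poly_eval A p.2.
Proof.
move=> mL sJ hJ; rewrite /theta big_flatten big_map sJ; congr (- _).
rewrite -[k in iota 0 k]subn0 -/(index_iota 0 k) big_mkord; apply: eq_bigr => i _.
set M := (X in form_eval _ _ X).
have {M}-> : M = subst_row (frame R k J) i (row i (frame R k J *m Q)).
  by apply/matrixP => a b; rewrite !mxE; case: eqP => [->|] //; rewrite !mxE.
rewrite big_map big_filter big_mkcond -[iota 1 7]/(index_iota 1 8) big_add1.
rewrite big_mkord.
rewrite /form_eval; under eq_bigr do rewrite coform_subst_frame mulr_sumr.
rewrite exchange_big /=; apply: eq_bigr => w _.
have nJ : (0 < nth 1 J i <= 7)%N by move/allP: hJ; apply; rewrite mem_nth ?sJ.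
transitivity (ent Q (nth 1%N J i) w.+1 *
    form_eval A L (frame R k (set_nth 1%N J i w.+1))).
  rewrite /form_eval mulr_sumr; apply: eq_bigr => t _; rewrite mulrCA; congr (_ * _).
  rewrite !mxE (bigD1 (idx J i)) //= big1 => [|c /negPf nc]; last first.
    by rewrite !mxE eq_sym nc mul0r.
  rewrite !mxE eqxx mul1r addr0 /ent; congr (Q _ _); apply/val_inj => /=.
  by rewrite modn_small.
rewrite form_eval_frame //; first last.
- apply/(all_nthP 1%N) => j; rewrite size_set_nth sJ (maxn_idPr (ltn_ord i)) => jk.
  rewrite nth_set_nth /=; case: eqP => // _; first by have := ltn_ord w; lia.
  by move/allP: hJ; apply; rewrite mem_nth ?sJ.
- by rewrite size_set_nth sJ (maxn_idPr (ltn_ord i)).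
by case: eqP => [->|//]; rewrite /poly_eval big_nil mulr0.
Qed.

End Laplacian.

(** * Components of the structure equations *)

(** Sums and products over explicit lists are turned into the recursive
    expressions below, which reduce to plain ring expressions free of units and
    zeros. *)
Section ExplicitSums.
Variable R : realType.

Definition scale_int (z : int) (x : R) : R :=
  match z with Posz 1 => x | Negz 0 => - x | _ => z%:~R * x end.

Fixpoint mono_expr (A : 'M[R]_6) (m : seq (nat * nat)) : R :=
  match m with
  | [::] => 1
  | [:: p] => ent A p.1 p.2
  | p :: m' => ent A p.1 p.2 * mono_expr A m'
  end.

Fixpoint poly_expr (A : 'M[R]_6) (P : seq monomial) : R :=
  match P with
  | [::] => 0
  | [:: t] => scale_int t.1 (mono_expr A t.2)
  | t :: P' => scale_int t.1 (mono_expr A t.2) + poly_expr A P'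
  end.

Fixpoint sum_expr T (F : T -> R) (s : seq T) : R :=
  match s with
  | [::] => 0
  | [:: x] => F x
  | x :: s' => F x + sum_expr F s'
  end.

Lemma big_sum_expr T (F : T -> R) s : \sum_(x <- s) F x = sum_expr F s.
Proof.
elim: s => [|x [|y s] IH]; first by rewrite big_nil.
  by rewrite big_seq1.
by rewrite big_cons IH.
Qed.

Lemma poly_evalE A P : poly_eval A P = poly_expr A P.
Proof.
have mono_evalE m : mono_eval A m = mono_expr A m.
  rewrite /mono_eval; elim: m => [|p [|q m] IH]; first by rewrite big_nil.
    by rewrite big_seq1.
  by rewrite big_cons IH.
have scaleE z x : scale_int z x = z%:~R * x.
  case: z => [[|[|n]]|[|n]] //=; first by rewrite mul1r.
  by rewrite NegzE rmorphN /= mulN1r.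
rewrite /poly_eval; elim: P => [|t [|u P] IH]; first by rewrite big_nil.
  by rewrite big_seq1 mono_evalE /= scaleE.
by rewrite big_cons IH mono_evalE -scaleE.
Qed.

End ExplicitSums.

Ltac expand_lists :=
  repeat match goal with
  | |- context [coefs ?L ?J] =>
      let l := eval vm_compute in (coefs L J) in
      have -> : coefs L J = l by vm_compute
  | |- context [theta_terms ?L ?J] =>
      let l := eval vm_compute in (theta_terms L J) in
      have -> : theta_terms L J = l by vm_compute
  end;
  rewrite ?big_sum_expr ?poly_evalE;
  cbv [sum_expr poly_expr mono_expr scale_int fst snd];
  (* the coefficients of a sum over theta_terms are only exposed by now *)
  rewrite ?poly_evalE;
  cbv [sum_expr poly_expr mono_expr scale_int fst snd].

Section Components.
Variable R : realType.
Implicit Type A : 'M[R]_6.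

Lemma coclosed_component A J : coclosed A -> size J = 5%N ->
  all (fun i => 0 < i <= 7)%N J -> poly_eval A (coefs (d_terms psi_terms) J) = 0.
Proof.
move=> hA sJ hJ.
have wf4 : all (fun t => multi_index 4 t.2) psi_terms by vm_compute.
have wf5 : all (fun t => multi_index 5 t.2) (d_terms psi_terms) by vm_compute.
rewrite -(form_eval_frame A wf5 sJ hJ) -(ext_d_form_eval A _ wf4).
by rewrite -(eq_ext_d _ _ (psi_form_eval A)) hA.
Qed.

Lemma laplacian_component A Q J : coclosed A -> is_QA A Q -> size J = 4%N ->
  all (fun i => 0 < i <= 7)%N J ->
  \sum_(p <- theta_terms psi_terms J) ent Q p.1.1 p.1.2 * poly_eval A p.2 =
  - poly_eval A (coefs laplacian_terms J).
Proof.
move=> hA [_ hQ] sJ hJ.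
have wf4 : all (fun t => multi_index 4 t.2) psi_terms by vm_compute.
have wf4' : all (fun t => multi_index 4 t.2) laplacian_terms by vm_compute.
rewrite -(form_eval_frame A wf4' sJ hJ) -(laplacian_psi hA) hQ.
rewrite -[LHS]opprK -(theta_form_eval A Q wf4 sJ hJ); congr (- _).
by rewrite /theta; congr (- _); apply: eq_bigr => i _; rewrite (psi_form_eval A).
Qed.

(** The condition A in sp(R^6), as rewriting rules that leave 21 independent
    entries.  There is one relation for each component of d psi along e^{abcd7}.
    If abcd consists of two of the pairs 12, 34, 56, the traces of the two
    diagonal blocks of A add up to 0; if it contains a single pair, two
    off-diagonal entries of A agree up to the sign. *)
Lemma coclosed_sp A : coclosed A ->
  (ent A 2 2 = - ent A 1 1) * (ent A 4 4 = - ent A 3 3) * (ent A 6 6 = - ent A 5 5) *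
  (ent A 3 1 = - ent A 2 4) * (ent A 4 2 = - ent A 1 3) *
  (ent A 3 2 = ent A 1 4) * (ent A 4 1 = ent A 2 3) *
  (ent A 5 1 = - ent A 2 6) * (ent A 6 2 = - ent A 1 5) *
  (ent A 5 2 = ent A 1 6) * (ent A 6 1 = ent A 2 5) *
  (ent A 5 3 = - ent A 4 6) * (ent A 6 4 = - ent A 3 5) *
  (ent A 5 4 = ent A 3 6) * (ent A 6 3 = ent A 4 5).
Proof.
move=> hA.
have c J := @coclosed_component A J hA.
have := c [:: 1; 2; 3; 4; 7]%N erefl isT.
have := c [:: 1; 2; 5; 6; 7]%N erefl isT.
have := c [:: 3; 4; 5; 6; 7]%N erefl isT.
expand_lists => E1 E2 E3.
have := c [:: 1; 2; 3; 5; 7]%N erefl isT.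
have := c [:: 1; 2; 3; 6; 7]%N erefl isT.
have := c [:: 1; 2; 4; 5; 7]%N erefl isT.
have := c [:: 1; 2; 4; 6; 7]%N erefl isT.
expand_lists => F1 F2 F3 F4.
have := c [:: 1; 3; 4; 5; 7]%N erefl isT.
have := c [:: 1; 3; 4; 6; 7]%N erefl isT.
have := c [:: 2; 3; 4; 5; 7]%N erefl isT.
have := c [:: 2; 3; 4; 6; 7]%N erefl isT.
expand_lists => G1 G2 G3 G4.
have := c [:: 1; 3; 5; 6; 7]%N erefl isT.
have := c [:: 1; 4; 5; 6; 7]%N erefl isT.
have := c [:: 2; 3; 5; 6; 7]%N erefl isT.
have := c [:: 2; 4; 5; 6; 7]%N erefl isT.
expand_lists => H1 H2 H3 H4.
by repeat split; lra.
Qed.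

End Components.

(** * The endomorphism Q *)

Section Q.
Variable R : realType.
Implicit Type A : 'M[R]_6.

Definition lap A i j k : R :=
  poly_eval A (coefs laplacian_terms [:: i; j; k; 7%N]).

(** Solution of the linear system theta(Q) psi = Delta psi for symmetric Q.  Each
    component of theta(Q) psi involves at most four entries of Q, and the
    components of Delta psi without a factor e^7 vanish. *)
Lemma QA_entries A Q : coclosed A -> is_QA A Q ->
  [/\ ent Q 1 1 = (lap A 2 3 5 - lap A 1 3 6 - lap A 1 4 5 - lap A 2 4 6) / 4,
      ent Q 2 2 = - ent Q 1 1,
      ent Q 3 3 = (lap A 1 4 5 - lap A 1 3 6 - lap A 2 3 5 - lap A 2 4 6) / 4,
      ent Q 4 4 = - ent Q 3 3 &
      ent Q 5 5 = (lap A 1 3 6 - lap A 1 4 5 - lap A 2 3 5 - lap A 2 4 6) / 4] /\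
  [/\ ent Q 6 6 = - ent Q 5 5,
      ent Q 7 7 = (lap A 2 4 6 - lap A 1 3 6 - lap A 1 4 5 - lap A 2 3 5) / 4,
      ent Q 1 2 = (lap A 1 4 6 - lap A 1 3 5) / 2,
      ent Q 3 4 = (lap A 2 3 6 - lap A 1 3 5) / 2 &
      ent Q 5 6 = (lap A 2 4 5 - lap A 1 3 5) / 2] /\
  [/\ ent Q 1 3 = lap A 1 2 5 / 2, ent Q 2 4 = - lap A 1 2 5 / 2,
      ent Q 1 4 = - lap A 1 2 6 / 2 & ent Q 2 3 = - lap A 1 2 6 / 2] /\
  [/\ ent Q 1 5 = - lap A 1 2 3 / 2, ent Q 2 6 = lap A 1 2 3 / 2,
      ent Q 1 6 = lap A 1 2 4 / 2 & ent Q 2 5 = lap A 1 2 4 / 2] /\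
  [/\ ent Q 3 5 = lap A 1 3 4 / 2, ent Q 4 6 = - lap A 1 3 4 / 2,
      ent Q 3 6 = - lap A 2 3 4 / 2 & ent Q 4 5 = - lap A 2 3 4 / 2].
Proof.
move=> hA hQ.
pose qsum J : R :=
  \sum_(p <- theta_terms psi_terms J) ent Q p.1.1 p.1.2 * poly_eval A p.2.
have ch J : size J = 4%N -> all (fun i => 0 < i <= 7)%N J ->
    coefs laplacian_terms J = [::] -> qsum J = 0.
  move=> sJ hJ e; rewrite /qsum laplacian_component // e.
  by rewrite /poly_eval big_nil oppr0.
have c7 i j k : all (fun i => 0 < i <= 7)%N [:: i; j; k] ->
    qsum [:: i; j; k; 7%N] = - lap A i j k.
  by move=> h; rewrite /qsum laplacian_component.
have sym i j : ent Q j i = ent Q i j by rewrite /ent -[in LHS](proj1 hQ) mxE.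
have sy := (sym 1 2, sym 1 3, sym 1 4, sym 1 5, sym 1 6, sym 1 7, sym 2 3,
  sym 2 4, sym 2 5, sym 2 6, sym 2 7, sym 3 4, sym 3 5, sym 3 6, sym 3 7, sym 4 5,
  sym 4 6, sym 4 7, sym 5 6, sym 5 7, sym 6 7)%N.
move: (lap A) c7 => d c7.
split; [|split; [|split; [|split]]].
- have := c7 2%N 4%N 6%N isT; have := c7 1%N 3%N 6%N isT.
  have := c7 1%N 4%N 5%N isT; have := c7 2%N 3%N 5%N isT.
  have := ch [:: 1; 2; 3; 4]%N erefl isT erefl.
  have := ch [:: 1; 2; 5; 6]%N erefl isT erefl.
  have := ch [:: 3; 4; 5; 6]%N erefl isT erefl.
  rewrite /qsum; expand_lists; rewrite ?sy => E1 E2 E3 E4 E5 E6 E7.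
  split; lra.
- have := c7 2%N 4%N 6%N isT; have := c7 1%N 3%N 6%N isT.
  have := c7 1%N 4%N 5%N isT; have := c7 2%N 3%N 5%N isT.
  have := ch [:: 1; 2; 3; 4]%N erefl isT erefl.
  have := ch [:: 1; 2; 5; 6]%N erefl isT erefl.
  have := ch [:: 3; 4; 5; 6]%N erefl isT erefl.
  have := c7 1%N 3%N 5%N isT; have := c7 1%N 4%N 6%N isT.
  have := c7 2%N 3%N 6%N isT; have := c7 2%N 4%N 5%N isT.
  rewrite /qsum; expand_lists; rewrite ?sy => E1 E2 E3 E4 E5 E6 E7 E8 E9 E10 E11.
  split; lra.
- have := c7 1%N 2%N 5%N isT; have := c7 1%N 2%N 6%N isT.
  have := ch [:: 1; 4; 5; 6]%N erefl isT erefl.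
  have := ch [:: 2; 3; 5; 6]%N erefl isT erefl.
  have := ch [:: 1; 3; 5; 6]%N erefl isT erefl.
  have := ch [:: 2; 4; 5; 6]%N erefl isT erefl.
  rewrite /qsum; expand_lists; rewrite ?sy => E1 E2 E3 E4 E5 E6.
  split; lra.
- have := c7 1%N 2%N 3%N isT; have := c7 1%N 2%N 4%N isT.
  have := ch [:: 1; 3; 4; 5]%N erefl isT erefl.
  have := ch [:: 1; 3; 4; 6]%N erefl isT erefl.
  have := ch [:: 2; 3; 4; 5]%N erefl isT erefl.
  have := ch [:: 2; 3; 4; 6]%N erefl isT erefl.
  rewrite /qsum; expand_lists; rewrite ?sy => E1 E2 E3 E4 E5 E6.
  split; lra.
- have := c7 1%N 3%N 4%N isT; have := c7 2%N 3%N 4%N isT.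
  have := ch [:: 1; 2; 3; 5]%N erefl isT erefl.
  have := ch [:: 1; 2; 3; 6]%N erefl isT erefl.
  have := ch [:: 1; 2; 4; 5]%N erefl isT erefl.
  have := ch [:: 1; 2; 4; 6]%N erefl isT erefl.
  rewrite /qsum; expand_lists; rewrite ?sy => E1 E2 E3 E4 E5 E6.
  split; lra.
Qed.
End Q.

Section Q.
Variable R : realType.
Implicit Type A S : 'M[R]_6.

(** The axes of C^3 are labelled by the real coordinates 1, 3, 5, cyclically
    ordered so that cofactors carry no sign. *)
Definition next_axis (i : nat) : nat := match i with 1 => 3 | 3 => 5 | _ => 1 end%N.

(** Real and imaginary part of the (i, j) cofactor of the complex 3 x 3 matrix with
    entries S_ij + i S_i(j+1), for i and j in {1, 3, 5}.  When S is the symmetric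
    part of an element of sp(R^6), it is determined by this matrix. *)
Definition cof_re S i j : R :=
  let i' := next_axis i in let i'' := next_axis i' in
  let j' := next_axis j in let j'' := next_axis j' in
  (ent S i' j' * ent S i'' j'' - ent S i' j'.+1 * ent S i'' j''.+1) -
  (ent S i' j'' * ent S i'' j' - ent S i' j''.+1 * ent S i'' j'.+1).

Definition cof_im S i j : R :=
  let i' := next_axis i in let i'' := next_axis i' in
  let j' := next_axis j in let j'' := next_axis j' in
  (ent S i' j' * ent S i'' j''.+1 + ent S i' j'.+1 * ent S i'' j'') -
  (ent S i' j'' * ent S i'' j'.+1 + ent S i' j''.+1 * ent S i'' j').

(** S o_6 S = sum S_mn S_pq rho^+_mpa rho^+_nqb for a symmetric S anticommuting with
    J.  As rho^+ is the real part of a complex volume form, this is four times the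
    complex conjugate of the cofactor matrix of S. *)
Definition circ6_entry S (i j : nat) : R :=
  match odd i, odd j with
  | true, true => 4 * cof_re S i j
  | true, false => - 4 * cof_im S i j.-1
  | false, true => - 4 * cof_im S i.-1 j
  | false, false => - 4 * cof_re S i.-1 j.-1
  end.

Definition circ6 S : 'M[R]_6 := \matrix_(i, j) circ6_entry S i.+1 j.+1.
(** With vectors as rows the matrix of ad(e_7) on column vectors is A^T, so this
    is [A, A^t] in the usual convention. *)
Definition commT A : 'M[R]_6 := A^T *m A - A *m A^T.
Definition sym_part A : 'M[R]_6 := 2^-1 *: (A + A^T).

(** The trace of J A, up to the sign. *)
Definition trJ A : R :=
  ent A 1 2 - ent A 2 1 + ent A 3 4 - ent A 4 3 + ent A 5 6 - ent A 6 5.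

Lemma mx_ent n (M : 'M[R]_n.+1) i j : M i j = ent M i.+1 j.+1.
Proof. by congr (M _ _); apply/val_inj; rewrite /= modn_small. Qed.

Lemma sum6 (F : nat -> R) :
  \sum_(i < 6) F i.+1 = F 1%N + F 2%N + F 3%N + F 4%N + F 5%N + F 6%N.
Proof. by rewrite !big_ord_recr big_ord0 /= add0r. Qed.

Lemma ent_sym_part A i j : ent (sym_part A) i j = (ent A i j + ent A j i) / 2.
Proof. by rewrite /ent !mxE mulrC. Qed.

Lemma ent_circ6 S i j : (0 < i <= 6)%N -> (0 < j <= 6)%N ->
  ent (circ6 S) i j = circ6_entry S i j.
Proof.
move=> hi hj; rewrite /ent mxE /=.
by rewrite !modn_small ?prednK //; lia.
Qed.

Lemma ent_commT A i j : (0 < i <= 6)%N -> (0 < j <= 6)%N ->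
  ent (commT A) i j =
  \sum_(k < 6) (ent A k.+1 i * ent A k.+1 j - ent A i k.+1 * ent A j k.+1).
Proof.
move=> hi hj; rewrite {1}/ent !mxE -sumrB; apply: eq_bigr => k _.
rewrite !mxE !mx_ent /= !modn_small ?prednK //; lia.
Qed.

(** An identity between quadratic polynomials in the 21 entries left free by
    [coclosed_sp]; it is checked for each pair (i, j). *)
Lemma QA_horizontal A Q i j : coclosed A -> is_QA A Q ->
    (0 < i <= 6)%N -> (0 < j <= 6)%N ->
  ent Q i j = (ent (commT A) i j + ent (circ6 (sym_part A)) i j) / 2.
Proof.
move=> hA hQ hi hj; have spA := coclosed_sp hA.
rewrite ent_circ6 ?ent_commT //.
rewrite (sum6 (fun k => ent A k i * ent A k j - ent A i k * ent A j k)).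
have [[Q11 Q22 Q33 Q44 Q55] [[Q66 _ Q12 Q34 Q56] [[Q13 Q24 Q14 Q23]
 [[Q15 Q26 Q16 Q25] [Q35 Q46 Q36 Q45]]]]] := QA_entries hA hQ.
have sym k l : ent Q l k = ent Q k l by rewrite /ent -[in LHS](proj1 hQ) mxE.
have Qs := (Q11, Q22, Q33, Q44, Q55, Q66, Q12, Q34, Q56,
  (Q13, Q24, Q14, Q23), (Q15, Q26, Q16, Q25), (Q35, Q46, Q36, Q45)).
have sy := (sym 1 2, sym 1 3, sym 1 4, sym 1 5, sym 1 6, sym 2 3,
  sym 2 4, sym 2 5, sym 2 6, sym 3 4, sym 3 5, sym 3 6, sym 4 5,
  sym 4 6, sym 5 6)%N.
move: i hi => [|[|[|[|[|[|[|i]]]]]]] // _; move: j hj => [|[|[|[|[|[|[|j]]]]]]] // _;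
  rewrite ?sy !Qs /lap; expand_lists;
  rewrite /circ6_entry /= /cof_re /cof_im /= !ent_sym_part !spA; clear; by field.
Qed.

Lemma QA_vertical A Q : coclosed A -> is_QA A Q ->
  ent Q 7 7 = - (\sum_i \sum_j sym_part A i j ^+ 2) / 2
    - trJ A ^+ 2 / 4.
Proof.
move=> hA hQ; have spA := coclosed_sp hA.
have [_ [[_ -> _ _ _] _]] := QA_entries hA hQ.
under eq_bigr do under eq_bigr do rewrite mx_ent ent_sym_part.
rewrite (sum6 (fun i => \sum_(j < 6) ((ent A i j.+1 + ent A j.+1 i) / 2) ^+ 2)).
rewrite !(sum6 (fun j => ((ent A _ j + ent A j _) / 2) ^+ 2)).
rewrite /lap /trJ; expand_lists; rewrite !spA; clear; by field.
Qed.

End Q.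

(** * The cofactor estimate *)

Section Bound.
Variable R : realType.
Implicit Type A S : 'M[R]_6.

Definition mxnorm2 n (M : 'M[R]_n) : R := \sum_i \sum_j M i j ^+ 2.

Definition row_norm2 S i : R := ent S i 1 ^+ 2 + ent S i 2 ^+ 2 + ent S i 3 ^+ 2
  + ent S i 4 ^+ 2 + ent S i 5 ^+ 2 + ent S i 6 ^+ 2.

Definition cof_norm2 S i : R :=
  \sum_(j <- [:: 1; 3; 5]%N) (cof_re S i j ^+ 2 + cof_im S i j ^+ 2).

(** The Lagrange identity: the sum of the squared moduli of the 2 x 2 minors of two
    complex rows is the product of their squared norms minus the squared modulus
    of their Hermitian product. *)
Lemma cof_norm2_le S i :
  cof_norm2 S i <= row_norm2 S (next_axis i) * row_norm2 S (next_axis (next_axis i)).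
Proof.
rewrite /cof_norm2 !big_cons big_nil /cof_re /cof_im /row_norm2 /=.
move: (next_axis i) (next_axis (next_axis i)) => k l; rewrite -subr_ge0.
set u := (X in 0 <= X).
(* real and imaginary part of the Hermitian product of rows k and l *)
have -> : u =
  (ent S k 1 * ent S l 1 + ent S k 2 * ent S l 2 + ent S k 3 * ent S l 3
   + ent S k 4 * ent S l 4 + ent S k 5 * ent S l 5 + ent S k 6 * ent S l 6) ^+ 2
  + (ent S k 2 * ent S l 1 - ent S k 1 * ent S l 2 + ent S k 4 * ent S l 3
   - ent S k 3 * ent S l 4 + ent S k 6 * ent S l 5 - ent S k 5 * ent S l 6) ^+ 2.
  by rewrite /u; ring.
by rewrite addr_ge0 ?sqr_ge0.
Qed.

Lemma mxnorm2_circ6 S :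
  mxnorm2 (circ6 S) = 32 * (cof_norm2 S 1 + cof_norm2 S 3 + cof_norm2 S 5).
Proof.
rewrite /mxnorm2; under eq_bigr do under eq_bigr do rewrite mxE.
rewrite (sum6 (fun i => \sum_(j < 6) circ6_entry S i j.+1 ^+ 2)).
rewrite !(sum6 (fun j => circ6_entry S _ j ^+ 2)) /cof_norm2.
by rewrite !big_cons !big_nil /circ6_entry /=; ring.
Qed.

Lemma mxnorm2_sym_part A : coclosed A ->
  mxnorm2 (sym_part A) =
  2 * (row_norm2 (sym_part A) 1 + row_norm2 (sym_part A) 3
       + row_norm2 (sym_part A) 5).
Proof.
move=> hA; have spA := coclosed_sp hA.
rewrite /mxnorm2; under eq_bigr do under eq_bigr do rewrite mx_ent.
rewrite (sum6 (fun i => \sum_(j < 6) ent (sym_part A) i j.+1 ^+ 2)).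
rewrite !(sum6 (fun j => ent (sym_part A) _ j ^+ 2)) /row_norm2 !ent_sym_part !spA.
by field.
Qed.

(** With n_1, n_2, n_3 the squared row norms of the complex matrix,
    |P|^2 <= 32 (n_1 n_2 + n_2 n_3 + n_3 n_1) <= 32/3 (n_1 + n_2 + n_3)^2, while
    |S|^2 = 2 (n_1 + n_2 + n_3). *)
Lemma circ6_bound A : coclosed A ->
  mxnorm2 (circ6 (sym_part A)) <= 8 / 3 * mxnorm2 (sym_part A) ^+ 2.
Proof.
move=> hA; rewrite mxnorm2_circ6 mxnorm2_sym_part //.
have := cof_norm2_le (sym_part A) 1; have := cof_norm2_le (sym_part A) 3.
have := cof_norm2_le (sym_part A) 5 => /=.
move: (cof_norm2 _ 1) (cof_norm2 _ 3) (cof_norm2 _ 5) => a b c.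
move: (row_norm2 _ 1) (row_norm2 _ 3) (row_norm2 _ 5) => x y z h1 h2 h3.
have := sqr_ge0 (x - y); have := sqr_ge0 (x - z); have := sqr_ge0 (y - z).
nra.
Qed.

Lemma mxnorm2_ge0 n (M : 'M[R]_n) : 0 <= mxnorm2 M.
Proof. by apply: sumr_ge0 => i _; apply: sumr_ge0 => j _; exact: sqr_ge0. Qed.

Lemma mxnorm2_eq0 n (M : 'M[R]_n) : mxnorm2 M = 0 -> M = 0.
Proof.
move=> h; apply/matrixP => i j; rewrite mxE; apply/eqP; rewrite -sqrf_eq0.
have h0 k l : 0 <= M k l ^+ 2 by exact: sqr_ge0.
have := @psumr_eq0P _ _ xpredT (fun k => \sum_l M k l ^+ 2)
  (fun k _ => sumr_ge0 _ (fun l _ => h0 k l)) h i isT.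
by move=> /(psumr_eq0P (fun l _ => h0 i l)) /(_ j isT) ->.
Qed.

Lemma mxnorm2_tr n (M : 'M[R]_n) : mxnorm2 M = \tr (M *m M^T).
Proof.
by apply: eq_bigr => i _; rewrite mxE; apply: eq_bigr => j _; rewrite mxE.
Qed.

(** |A|^2 - |S|^2 is the squared norm of the skew part. *)
Lemma mxnorm2_sym_part_le A : mxnorm2 (sym_part A) <= mxnorm2 A.
Proof.
have E : mxnorm2 A - mxnorm2 (sym_part A) = mxnorm2 (2^-1 *: (A - A^T)).
  have trE : mxnorm2 A = \sum_i \sum_j (A i j ^+ 2 + A j i ^+ 2) / 2.
    rewrite /mxnorm2 [LHS](_ : _ = (mxnorm2 A + mxnorm2 A) / 2); last first.
      by rewrite /mxnorm2; field.
    rewrite {2}/mxnorm2 exchange_big /mxnorm2 -big_split mulr_suml.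
    apply: eq_bigr => i _ /=.
    by rewrite -big_split mulr_suml.
  rewrite trE /mxnorm2 -sumrB; apply: eq_bigr => i _.
  rewrite -sumrB; apply: eq_bigr => j _.
  by rewrite !mxE; field.
by rewrite -subr_ge0 E mxnorm2_ge0.
Qed.

End Bound.

(** * The trace identity and the bound on c *)

Section Derivation.
Variable R : realType.
Implicit Type (A : 'M[R]_6) (D Q : 'M[R]_7).

Definition hblock D : 'M[R]_6 := @ulsubmx _ 6 1 6 1 D.

Lemma ent_hblock D i j : (0 < i <= 6)%N -> (0 < j <= 6)%N ->
  ent (hblock D) i j = ent D i j.
Proof.
move=> hi hj; rewrite /hblock /ent !mxE.
by congr (D _ _); apply/val_inj; rewrite /= !modn_small //; lia.
Qed.

Lemma trmx_commT A : (commT A)^T = commT A.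
Proof. by rewrite /commT linearB /= !trmx_mul !trmxK. Qed.

(** The derivation rule for [e_7, e_i], read off in h.  A component of D e_i along
    e_7 contributes [e_7, e_7] = 0, and one of D e_7 in h brackets trivially with
    e_i. *)
Lemma derivation_hblock A D : derivation (almost_abelian_bracket A) D ->
  A *m hblock D = D ord_max ord_max *: A + hblock D *m A.
Proof.
move=> hD; apply/matrixP => i j.
pose w (k : 'I_6) : 'I_7 := widen_ord (leqnSn 6) k.
have adw k l : ad7 A (w k) (w l) = A k l.
  have wl (m : 'I_6) : (w m < 6)%N by exact: ltn_ord m.
  by rewrite ad7E !wl mx_ent.
have adl k : ad7 A k ord_max = 0 by rewrite ad7E andbF.
have adr k : ad7 A ord_max k = 0 by rewrite ad7E.
have hb k l : hblock D k l = D (w k) (w l).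
  by rewrite !mxE; congr (D _ _); apply/val_inj.
pose e (k : 'I_7) : 'rV[R]_7 := delta_mx 0 k.
have eM k (M : 'M[R]_7) l : (e k *m M) 0 l = M k l by rewrite -rowE mxE.
have e7 : e ord_max *m ad7 A = 0 by apply/rowP => l; rewrite eM adr mxE.
have := hD (e ord_max) (e (w i)); rewrite !bracketE e7 !scaler0 !subr0.
have -> : e ord_max 0 ord_max = 1 by rewrite mxE !eqxx.
have -> : e (w i) 0 ord_max = 0.
  by rewrite mxE eqxx -val_eqE /= gtn_eqF // ltn_ord.
rewrite !scale1r scale0r subr0 eM => /rowP /(_ (w j)).
rewrite [RHS]mxE [X in _ = X + _]mxE eM adw -!mulmxA !eM.
have sum7 (F : 'I_7 -> R) : \sum_k F k = \sum_k F (w k) + F ord_max.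
  by rewrite big_ord_recr.
rewrite !mxE !sum7 adl mul0r addr0 adr mulr0 addr0.
under eq_bigr do rewrite adw.
under [X in _ = _ + X]eq_bigr do rewrite adw.
by under eq_bigr do rewrite -hb; under [X in _ = _ + X]eq_bigr do rewrite -hb.
Qed.

(** tr (D_h C) = tr ((A D_h - D_h A) A^T) = a |A|^2, and C is blind to the
    scalar and skew parts of D_h. *)
Lemma trace_identity A D Q c : derivation (almost_abelian_bracket A) D ->
    Q = c%:M + 2^-1 *: (D + D^T) ->
  \tr (hblock Q *m commT A) = (ent Q 7 7 - c) * mxnorm2 A.
Proof.
move=> hD hQ; have hd := derivation_hblock hD.
have q7 : ent Q 7 7 - c = D ord_max ord_max.
  have -> : ent Q 7 7 = Q ord_max ord_max by congr (Q _ _); apply/val_inj.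
  by rewrite hQ !mxE eqxx /=; field.
have hQh : hblock Q = c%:M + 2^-1 *: (hblock D + (hblock D)^T).
  by rewrite hQ; apply/matrixP => i j; rewrite !mxE.
have symC := trmx_commT A.
have trC : \tr (commT A) = 0 by rewrite /commT linearB /= mxtrace_mulC subrr.
have trDC : \tr (hblock D *m commT A) = D ord_max ord_max * mxnorm2 A.
  rewrite mxnorm2_tr -mxtraceZ scalemxAl /commT mulmxBr linearB /=.
  rewrite !mulmxA [\tr (_ *m A^T *m A)]mxtrace_mulC mulmxA hd.
  by rewrite mulmxDl linearD /= addrK.
rewrite hQh mulmxDl linearD /= mul_scalar_mx mxtraceZ trC mulr0 add0r.
rewrite -scalemxAl mxtraceZ mulmxDl linearD /= q7.
have -> : \tr ((hblock D)^T *m commT A) = \tr (hblock D *m commT A).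
  by rewrite -mxtrace_tr trmx_mul trmxK symC mxtrace_mulC.
by rewrite trDC; field.
Qed.

Lemma soliton_bound A D Q c : coclosed A -> A <> 0 -> is_QA A Q ->
    derivation (almost_abelian_bracket A) D -> Q = c%:M + 2^-1 *: (D + D^T) ->
  c <= - (mxnorm2 (sym_part A) / 6 + trJ A ^+ 2 / 4).
Proof.
move=> hA nA hQA hD hQ.
have := trace_identity hD hQ.
rewrite (QA_vertical hA hQA) -/(mxnorm2 (sym_part A)).
set tau2 := (_ ^+ 2); set P := circ6 (sym_part A).
have -> : hblock Q = 2^-1 *: (commT A + P).
  apply/matrixP => i j; rewrite mx_ent ent_hblock ?ltn_ord //.
  rewrite (QA_horizontal hA hQA) ?ltn_ord // -!mx_ent.
  by rewrite !mxE mulrC.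
have symC := trmx_commT A.
(* completing the square in tr (C C) + tr (P C) *)
have : 0 <= mxnorm2 (commT A + 2^-1 *: P) by exact: mxnorm2_ge0.
have -> : mxnorm2 (commT A + 2^-1 *: P) =
    2 * \tr (2^-1 *: (commT A + P) *m commT A) + mxnorm2 P / 4.
  rewrite /mxtrace /mxnorm2 !mulr_sumr !mulr_suml -big_split.
  apply: eq_bigr => i _ /=; rewrite [X in 2 * X]mxE.
  rewrite !mulr_sumr !mulr_suml -big_split; apply: eq_bigr => j _ /=.
  have -> : commT A j i = commT A i j by rewrite -[in LHS]symC mxE.
  move: (commT A) P => C P; by rewrite !mxE; field.
have := circ6_bound hA; have := mxnorm2_sym_part_le A.
have := mxnorm2_ge0 (sym_part A).
have A0 : 0 < mxnorm2 A.
  rewrite lt_neqAle mxnorm2_ge0 andbT eq_sym; apply/eqP.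
  by move=> /mxnorm2_eq0.
rewrite -/P; move: (\tr _) (mxnorm2 P) (mxnorm2 (sym_part A)) (mxnorm2 A) A0.
move=> t p s a a0 s0 sa hp h0 ht.
rewrite -(ler_pM2r a0); nra.
Qed.

End Derivation.

(** * The torsion-free case *)

Definition ascending (s : seq nat) : seq nat := [seq i <- iota 1 7 | i \in s].

Definition sort_terms (L : seq coframe_term) : seq coframe_term :=
  [seq (t.1.1 * kron (ascending t.2) t.2, t.1.2, ascending t.2) | t <- L].

Section TorsionFree.
Variable R : realType.
Implicit Type A : 'M[R]_6.

(** The columns s of v are the columns t multiplied by a 0-1 matrix whose determinant
    is the Kronecker symbol. *)
Lemma coform_reorder k s t (v : 'M[R]_(k, 7)) : multi_index k t -> size s = k ->
  {subset s <= t} -> coform s v = (kron t s)%:~R * coform t v.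
Proof.
move=> mt ss st; case/and3P: (mt) => /eqP sz /allP ht ut.
rewrite !coformE -(det_kron _ ut sz ss) mulrC -[X in _ * X]det_tr -det_mulmx.
congr (\det _); apply/matrixP => a c; rewrite !mxE.
have sc : nth 1%N s c \in t by rewrite st // mem_nth ?ss.
have ix : (index (nth 1%N s c) t < k)%N by move: sc; rewrite -index_mem sz.
rewrite (bigD1 (Ordinal ix)) //= big1 => [|b nb].
  by rewrite !mxE nth_index // eqxx mulr1 addr0 /idx /= nth_index.
rewrite !mxE (_ : _ == _ = false) ?mulr0 //; apply/eqP => e; case/eqP: nb.
by apply/val_inj; rewrite /= e index_uniq ?sz.
Qed.

Lemma form_eval_sort A k L v : all (fun t => multi_index k t.2) L ->
  form_eval A L v = @form_eval R A k (sort_terms L) v.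
Proof.
move=> mL; rewrite /form_eval big_map; apply: eq_big_seq => t /(allP mL) mt.
have [/eqP sz /allP hs us] := and3P mt.
have mem_asc : ascending t.2 =i t.2.
  move=> i; rewrite mem_filter mem_iota andb_idr // => /hs /=; lia.
have szA : size (ascending t.2) = k.
  by rewrite -sz; apply/perm_size/uniq_perm; rewrite ?filter_uniq ?iota_uniq.
rewrite (@coform_reorder k t.2 (ascending t.2)) //.
- by rewrite /= intrM; ring.
- rewrite /multi_index szA eqxx filter_uniq ?iota_uniq // andbT.
  by apply/allP => i; rewrite mem_asc; exact: hs.
- by move=> i; rewrite mem_asc.
Qed.

Lemma form_evalE A k L v : @form_eval R A k L v =
  sum_expr (fun t => scale_int t.1.1 (mono_expr A t.1.2) * coform t.2 v) L.
Proof.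
rewrite -big_sum_expr; apply: eq_bigr => t _; congr (_ * _).
by rewrite -[RHS]/(poly_expr A [:: t.1]) -poly_evalE /poly_eval big_seq1.
Qed.

(** S = 0 puts A in u(3), and tr JA = 0 then in su(3), which fixes rho^+.  Reordering
    the factors of every monomial of d phi makes the cancellations visible to
    ring. *)
Lemma torsion_free_sufficient A : coclosed A -> sym_part A = 0 -> trJ A = 0 ->
  torsion_free A.
Proof.
move=> hA S0; rewrite /trJ => tau0; split=> // v; have spA := coclosed_sp hA.
have skew i j : ent A i j + ent A j i = 0.
  have := ent_sym_part A i j; rewrite S0 /ent mxE => /esym /eqP.
  by rewrite mulf_eq0 invr_eq0 pnatr_eq0 orbF => /eqP.
have [s11 s33 s55] := And3 (skew 1 1) (skew 3 3) (skew 5 5)%N.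
have := skew 1 2; have := skew 3 4; have := skew 5 6.
have := skew 1 3; have := skew 1 4; have := skew 1 5; have := skew 1 6.
have := skew 3 5; have := skew 3 6; rewrite !spA.
move=> e36 e35 e16 e15 e14 e13 e56 e34 e12.
have a11 : ent A 1 1 = 0 by lra.
have a33 : ent A 3 3 = 0 by lra.
have a55 : ent A 5 5 = 0 by lra.
have a21 : ent A 2 1 = - ent A 1 2 by lra.
have a43 : ent A 4 3 = - ent A 3 4 by lra.
have a24 : ent A 2 4 = ent A 1 3 by lra.
have a23 : ent A 2 3 = - ent A 1 4 by lra.
have a26 : ent A 2 6 = ent A 1 5 by lra.
have a25 : ent A 2 5 = - ent A 1 6 by lra.
have a46 : ent A 4 6 = ent A 3 5 by lra.
have a45 : ent A 4 5 = - ent A 3 6 by lra.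
have a56 : ent A 5 6 = - ent A 1 2 - ent A 3 4 by lra.
have a65 : ent A 6 5 = ent A 1 2 + ent A 3 4 by lra.
rewrite dphi_form_eval form_eval_sort; last by vm_compute.
rewrite form_evalE.
let l := eval vm_compute in (sort_terms dphi_terms) in
  have -> : sort_terms dphi_terms = l by vm_compute.
cbv [sum_expr poly_expr mono_expr scale_int fst snd].
rewrite !spA a11 a33 a55 a21 a43 a24 a23 a26 a25 a46 a45 a56 a65.
ring.
Qed.

Lemma theta0 k (al : Defs.form R k) A L : al =1 form_eval A L ->
  theta 0 al =1 fun=> 0.
Proof.
move=> e v; rewrite /theta big1 ?oppr0 // => i _.
rewrite e /form_eval big1 // => t _.
set M := (X in coform _ X); have -> : M = subst_row v i 0.
  by apply/matrixP => a b; rewrite [LHS]mxE mulmx0 !mxE.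
by rewrite coform_subst_row big1 ?mulr0 // => c _; rewrite mxE mul0r.
Qed.

Lemma is_QA0 A : torsion_free A -> is_QA A 0.
Proof.
move=> [hA h0]; split; first exact: trmx0.
move=> v; rewrite laplacian_coclosed // (theta0 (psi_form_eval 0)).
rewrite (@eq_ext_d _ _ _ _ (fun=> 0)) ?ext_d0 // => w.
by rewrite (@eq_hodge _ _ _ _ (fun=> 0)) ?hodge0.
Qed.

(** Both blocks are given by formulas in A alone. *)
Lemma QA_unique_blocks A Q Q' : coclosed A -> is_QA A Q -> is_QA A Q' ->
  hblock Q = hblock Q' /\ ent Q 7 7 = ent Q' 7 7.
Proof.
move=> hA hQ hQ'; split; last by rewrite !(QA_vertical hA).
apply/matrixP => i j; rewrite !mx_ent !ent_hblock ?ltn_ord //.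
by rewrite !(QA_horizontal hA) ?ltn_ord.
Qed.

End TorsionFree.

Theorem proposition4p10 (R : realType) (A : 'M[R]_6) (c : R)
    (A_neq0 : A <> 0) (hcoclosed : coclosed A)
    (hsoliton : algebraic_soliton A c \/ semi_algebraic_soliton A c) :
  (~ torsion_free A -> expanding (soliton_constant c)) /\
  (torsion_free A -> steady (soliton_constant c)).
Proof.
have [Q [D [hQA hD hQ]]] : semi_algebraic_soliton A c.
  by case: hsoliton => // -[Q [D [? ? _ ?]]]; exists Q, D.
split=> [ntf|tf].
- have bound := soliton_bound hcoclosed A_neq0 hQA hD hQ.
  suff c0 : c < 0 by rewrite /expanding /soliton_constant; lra.
  rewrite ltNge; apply/negP => c0; apply: ntf.
  have s0 := mxnorm2_ge0 (sym_part A).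
  move: bound; set t := trJ A => bound; have t0 := sqr_ge0 t.
  have /mxnorm2_eq0 S0 : mxnorm2 (sym_part A) = 0 by lra.
  have /eqP : t ^+ 2 = 0 by lra.
  by rewrite sqrf_eq0 => /eqP; apply: torsion_free_sufficient.
have [h0 q0] := QA_unique_blocks hcoclosed hQA (is_QA0 tf).
have := trace_identity hD hQ; rewrite h0 q0.
have -> : hblock (0 : 'M[R]_7) = 0 by apply/matrixP => i j; rewrite !mxE.
rewrite mul0mx linear0 [ent _ _ _]mxE sub0r => /esym /eqP.
rewrite mulf_eq0 oppr_eq0 => /orP[/eqP -> | /eqP /mxnorm2_eq0 //].
by rewrite /steady /soliton_constant mulr0.
Qed.
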